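(* Let $a,b\ge1$ and $P=[a]\times[b]$ with the product order. Let $x_1,\dots,x_{ab}$ be any enumeration of the elements $(k,\ell)$ of $P$ in weakly increasing order of $\ell-k$, and define promotion $\partial_J:J(P)\to J(P)$ by $\partial_J=\sigma_{x_{ab}}\circ\sigma_{x_{ab-1}}\circ\cdots\circ\sigma_{x_1}$. Then the cardinality statistic $I\mapsto\#I$ is $c$-mesic under $\partial_J$ with $c=ab/2$: for every $\partial_J$-orbit $\mathcal{O}\subseteq J(P)$, $\frac{1}{\#\mathcal{O}}\sum_{I\in\mathcal{O}}\#I=\frac{ab}{2}$.
   Context: $[n]$ denotes the chain $1<2<\dots<n$; in $[a]\times[b]$, $(k,\ell)\le(k',\ell')$ iff $k\le k'$ and $\ell\le\ell'$. $J(P)$ is the set of order ideals (down-closed subsets) of $P$. For $x\in P$, the toggle $\sigma_x:J(P)\to J(P)$ sends $I$ to $I\triangle\{x\}$ if this is an order ideal, and to $I$ otherwise. Toggles at elements with the same value of $\ell-k$ commute, so $\partial_J$ does not depend on the chosen enumeration; $\partial_J$ is invertible of finite order. $c$-mesic means the average over every orbit equals $c$. *)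

(* Defs.v *)
From HB Require Import structures.
From mathcomp Require Import all_boot all_order all_algebra.

Set Implicit Arguments.
Unset Strict Implicit.
Unset Printing Implicit Defensive.

Import Order.TTheory GRing.Theory Num.Theory.
Local Open Scope ring_scope.

Section OrderIdeals.
Variables (d : Order.disp_t) (P : finPOrderType d).

Definition order_ideal (I : {set P}) : bool :=
  [forall x in I, forall y, (y <= x)%O ==> (y \in I)].

Definition ideals : finType := {I : {set P} | order_ideal I}.

Definition flip (x : P) (I : {set P}) : {set P} :=
  (I :\: [set x]) :|: ([set x] :\: I).

(* [insubd I A] is [A] when [A] is an order ideal and [I] otherwise. *)
Definition toggle (x : P) (I : ideals) : ideals := insubd I (flip x (val I)).

(* The head of [xs] is toggled first. *)
Definition toggles (xs : seq P) (I : ideals) : ideals :=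
  foldl (fun J x => toggle x J) I xs.

Lemma flipK (x : P) : involutive (flip x).
Proof.
by move=> A; apply/setP => y; rewrite !inE; case: (y == x); case: (y \in A).
Qed.

Lemma toggleK (x : P) : involutive (toggle x).
Proof.
move=> I; apply: val_inj; rewrite /toggle !val_insubd.
case idI: (order_ideal (flip x (val I))); first by rewrite flipK (valP I).
by rewrite idI.
Qed.

Lemma toggles_inj (xs : seq P) : injective (toggles xs).
Proof.
elim: xs => [|x xs IHxs] I J; first by [].
by move/IHxs; apply: (inv_inj (toggleK x)).
Qed.

End OrderIdeals.

(* Forward orbits under [fconnect f] are genuine orbits when [f] is injective;
   [toggles_inj] covers the use made of it here. *)
Definition is_orbit (T : finType) (f : T -> T) (O : {set T}) : Prop :=
  exists x, O = [set y | fconnect f x y].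

Definition mesic (T : finType) (f : T -> T) (stat : T -> rat) (c : rat) : Prop :=
  forall O : {set T}, is_orbit f O -> #|O|%:R^-1 * (\sum_(I in O) stat I) = c.

(* The chain [n] is encoded as 'I_n, so (k, l) is represented by (k-1, l-1);
   this leaves l - k unchanged. *)
Definition rect (a b : nat) : finPOrderType _ := ('I_a *p 'I_b)%type.

Definition file (a b : nat) (x : rect a b) : int := x.2%:Z - x.1%:Z.

Definition file_enumeration (a b : nat) (xs : seq (rect a b)) : Prop :=
  [/\ uniq xs, forall x, x \in xs
    & sorted (fun x y => file x <= file y) xs].

Definition promotion (a b : nat) (xs : seq (rect a b)) :
  ideals (rect a b) -> ideals (rect a b) := toggles xs.

(* Main.v *)
Require Import Defs.
From HB Require Import structures.
From mathcomp Require Import all_boot all_order all_algebra.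
From mathcomp Require Import zify ring.
Import Order.TTheory GRing.Theory Num.Theory.
Local Open Scope ring_scope.

(** Let [h_i(I)] be the number of elements of [I] on the [i]-th file, files being
    numbered from [0] to [a + b] so that the two extreme files are empty.  Writing
    [I'] for the promotion of [I], a toggle at file [i] sees file [i - 1] of [I']
    and file [i + 1] of [I], and its effect is affine:
    [h_i(I') + h_i(I) = h_(i-1)(I') + h_(i+1)(I) + [i = a]].
    Summed over an orbit of size [N], this says that the totals [S_i] of [h_i]
    satisfy [2 S_i = S_(i-1) + S_(i+1) + N [i = a]] with [S_0 = S_(a+b) = 0].
    Summation by parts against [i (a + b - i)], whose second difference is [-2],
    yields [2 (S_0 + ... + S_(a+b)) = N a b]. *)

(** * Membership in order ideals after a toggle *)

Section Toggles.
Variables (d : Order.disp_t) (P : finPOrderType d).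
Implicit Types (I : ideals P) (x y z : P).

Lemma order_idealP (A : {set P}) :
  reflect (forall x y, x \in A -> (y <= x)%O -> y \in A) (order_ideal A).
Proof.
apply: (iffP forall_inP) => [H x y xA yx | H x xA].
  by move/forallP: (H x xA) => /(_ y) /implyP; apply.
by apply/forallP => y; apply/implyP; apply: H xA.
Qed.

Lemma idealsP I x y : x \in val I -> (y <= x)%O -> y \in val I.
Proof. by move: x y; apply/order_idealP; apply: valP. Qed.

Lemma in_flip x (A : {set P}) y :
  (y \in flip x A) = if y == x then y \notin A else y \in A.
Proof. by rewrite !inE; case: eqP; rewrite ?andbT ?andbF ?orbF. Qed.

Lemma toggle_neq x y I : y != x -> (y \in val (toggle x I)) = (y \in val I).
Proof.
move=> yx; rewrite /toggle val_insubd; case: ifP => // _.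
by rewrite in_flip (negPf yx).
Qed.

Lemma toggles_notin xs y I :
  y \notin xs -> (y \in val (toggles xs I)) = (y \in val I).
Proof.
elim: xs I => [|x xs IH] I //=; rewrite inE negb_or => /andP[yx yxs].
by rewrite IH // toggle_neq.
Qed.

(** Flipping [x] can break down-closure only at a pair involving [x]: removal fails when an element
    of [I] sits above it, insertion when an element below it is missing. *)
Lemma in_toggle x I :
  (x \in val (toggle x I)) =
  if x \in val I then [exists y in val I, (x < y)%O]
  else [forall y, (y < x)%O ==> (y \in val I)].
Proof.
rewrite /toggle val_insubd.
case: ifPn => [/order_idealP idl | nidl].
  rewrite in_flip eqxx; case: ifP => xI /=.
    apply/esym/negbTE/negP => /exists_inP[y yI xy].
    have := idl y x; rewrite !in_flip eqxx xI (gt_eqF xy).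
    by move=> /(_ yI (ltW xy)).
  apply/esym/forallP => y; apply/implyP => yx.
  by have := idl x y; rewrite !in_flip eqxx xI (lt_eqF yx) (ltW yx); apply.
case: ifP => xI /=.
  apply/esym; apply: contraR nidl => /exists_inPn nup.
  apply/order_idealP => y z; rewrite !in_flip.
  case: eqP => [->|yx]; rewrite ?xI // => yI zy.
  case: eqP => [zx|_]; last exact: idealsP zy.
  move: (nup y yI); rewrite lt_neqAle -zx zy andbT negbK eq_sym => /eqP.
  by rewrite zx.
apply/esym/negbTE; apply: contra nidl => /forallP low.
apply/order_idealP => y z; rewrite !in_flip.
case: (z =P x) => [->|/eqP zx]; rewrite ?xI //.
case: eqP => [-> _ zy|yx yI zy]; last exact: idealsP zy.
by have /implyP := low z; apply; rewrite lt_neqAle zx zy.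
Qed.

End Toggles.

(** * Coordinates in the rectangle and the local effect of promotion *)

Lemma rect_leE (a b : nat) (x y : rect a b) :
  (x <= y)%O = (x.1 <= y.1)%N && (x.2 <= y.2)%N.
Proof. by []. Qed.

Lemma rect_eqE (a b : nat) (x y : rect a b) :
  (x == y) = (x.1 == y.1 :> nat) && (x.2 == y.2 :> nat).
Proof. by []. Qed.

Lemma rect_ltE (a b : nat) (x y : rect a b) :
  (x < y)%O = [&& (x.1 <= y.1)%N, (x.2 <= y.2)%N & (x.1 + x.2 < y.1 + y.2)%N].
Proof. by rewrite lt_neqAle rect_leE rect_eqE; lia. Qed.

Section Rect.
Variables a b : nat.
Implicit Types (I : ideals (rect a b)) (x y : rect a b).

(** Natural-number indices allow shifts past the rectangle, where the value is [false]; shifts below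
    0 are truncated, hence the tests for 0 in later statements. *)
Definition mem_at I (k l : nat) : bool :=
  [exists x in val I, (x.1 == k :> nat) && (x.2 == l :> nat)].

Lemma mem_at_in I x : mem_at I x.1 x.2 = (x \in val I).
Proof.
apply/exists_inP/idP => [[y yI] | xI]; last by exists x; rewrite ?eqxx.
by rewrite -rect_eqE => /eqP <-.
Qed.

Lemma mem_at_support I k l : mem_at I k l -> (k < a)%N && (l < b)%N.
Proof. by case/exists_inP => x _ /andP[/eqP <- /eqP <-]; rewrite !ltn_ord. Qed.

Lemma mem_at_eq I (J : ideals (rect a b)) k l :
    (forall x : rect a b, x.1 = k :> nat -> x.2 = l :> nat ->
      (x \in val I) = (x \in val J)) ->
  mem_at I k l = mem_at J k l.
Proof.
move=> H; apply/exists_inP/exists_inP => -[x xI /andP[/eqP xk /eqP xl]];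
  by exists x; rewrite ?xk ?xl ?eqxx // ?(H x xk xl) // -(H x xk xl).
Qed.

Lemma rect_point (k l : nat) : (k < a)%N -> (l < b)%N ->
  exists2 x : rect a b, x.1 = k :> nat & x.2 = l :> nat.
Proof. by move=> ka lb; exists (Ordinal ka, Ordinal lb). Qed.

(** Any [y] strictly above [x] dominates one of the two covers of [x], which then lies in [I] by
    down-closure. *)
Lemma exists_above_at I x :
  [exists y in val I, (x < y)%O] = mem_at I x.1.+1 x.2 || mem_at I x.1 x.2.+1.
Proof.
apply/exists_inP/orP => [[y yI] | [] /exists_inP[y yI /andP[/eqP y1 /eqP y2]]].
- rewrite rect_ltE => xy.
  have [lt1|ge1] := ltnP x.1 y.1.
    left; have [z z1 z2] := rect_point x.1.+1 x.2
      (leq_ltn_trans lt1 (ltn_ord _)) (ltn_ord _).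
    by rewrite -z1 -z2 mem_at_in; apply: idealsP yI _; rewrite rect_leE; lia.
  have lt2 : (x.2 < y.2)%N by lia.
  right; have [z z1 z2] := rect_point x.1 x.2.+1 (ltn_ord _)
      (leq_ltn_trans lt2 (ltn_ord _)).
  by rewrite -z1 -z2 mem_at_in; apply: idealsP yI _; rewrite rect_leE; lia.
- by exists y => //; rewrite rect_ltE; lia.
- by exists y => //; rewrite rect_ltE; lia.
Qed.

Lemma forall_below_at I x :
  [forall y, (y < x)%O ==> (y \in val I)] =
  ((x.1 == 0%N :> nat) || mem_at I x.1.-1 x.2) &&
  ((x.2 == 0%N :> nat) || mem_at I x.1 x.2.-1).
Proof.
have a1 := ltn_ord x.1; have b2 := ltn_ord x.2.
apply/forallP/andP => [low | [low1 low2] y].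
  split; case: eqP => // nz; rewrite orFb.
    have [z z1 z2] := rect_point x.1.-1 x.2 ltac:(lia) b2.
    by rewrite -z1 -z2 mem_at_in; apply: (implyP (low z)); rewrite rect_ltE; lia.
  have [z z1 z2] := rect_point x.1 x.2.-1 a1 ltac:(lia).
  by rewrite -z1 -z2 mem_at_in; apply: (implyP (low z)); rewrite rect_ltE; lia.
apply/implyP; rewrite rect_ltE => yx.
have [lt1|ge1] := ltnP y.1 x.1.
  move: low1 => /orP[/eqP|/exists_inP[z zI /andP[/eqP z1 /eqP z2]]]; first lia.
  by apply: idealsP zI _; rewrite rect_leE; lia.
move: low2 => /orP[/eqP|/exists_inP[z zI /andP[/eqP z1 /eqP z2]]]; first lia.
by apply: idealsP zI _; rewrite rect_leE; lia.
Qed.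

(* If [x] is in [I] then so is everything below it, and if not then nothing
   above it is: in each case one of the two tests on the right is decided. *)
Lemma toggle_at I x :
  ((x \in val (toggle x I)) + (x \in val I) =
   (((x.1 == 0%N :> nat) || mem_at I x.1.-1 x.2) &&
    ((x.2 == 0%N :> nat) || mem_at I x.1 x.2.-1)) +
   (mem_at I x.1.+1 x.2 || mem_at I x.1 x.2.+1))%N.
Proof.
rewrite in_toggle -exists_above_at -forall_below_at; case: ifP => xI.
  rewrite addnC; congr (nat_of_bool _ + _)%N; apply/esym/forallP => y.
  by apply/implyP => /ltW; apply: idealsP xI.
rewrite addn0 [X in (_ + X)%N](_ : _ = 0%N) ?addn0 //.
case: exists_inP => // -[y yI /ltW xy].
by rewrite (idealsP _ _ _ _ _ yI xy) in xI.
Qed.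

(** Let [J] be the ideal just before [x] is toggled. On smaller files [J] already agrees with the
    final ideal, on larger files still with [I], so [toggle_at] for [J] gives the claim. *)
Lemma promotion_at (xs : seq (rect a b)) I (k l : nat) :
    file_enumeration xs -> (k < a)%N -> (l < b)%N ->
  (mem_at (promotion xs I) k l + mem_at I k l =
   (((k == 0) || mem_at I k.-1 l) &&
    ((l == 0) || mem_at (promotion xs I) k l.-1)) +
   (mem_at (promotion xs I) k.+1 l || mem_at I k l.+1))%N.
Proof.
case=> uxs axs sxs ka lb.
have [x x1 x2] := rect_point k l ka lb.
rewrite -x1 -x2 {k l ka lb x1 x2}.
have /splitPr xsE := axs x; case: xsE uxs axs sxs => s1 s2 uxs _ sxs.
set J := toggles s1 I; set I' := promotion _ I.
have I'E : I' = toggles s2 (toggle x J) by rewrite /I' /promotion /toggles foldl_cat.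
have file_trans : transitive (fun y z : rect a b => file y <= file z).
  by move=> y z t; apply: le_trans.
have s1_le y : y \in s1 -> file y <= file x.
  move: sxs; rewrite sorted_pairwise // pairwise_cat => /and3P[/allrelP H _ _] ys1.
  by apply: H; rewrite // inE eqxx.
have s2_ge y : y \in s2 -> file x <= file y.
  move: sxs; rewrite sorted_pairwise // pairwise_cat /= => /and4P[_ _ /allP H _].
  exact: H.
have xNs : x \notin s1 /\ x \notin s2.
  by move: uxs; rewrite cat_uniq /= negb_or => /and4P[_ /andP[-> _] -> _].
(* Points on the file of [x] may occur on either side of it in the enumeration, so only strict
   inequalities settle [J]. These suffice: the neighbours of [x] lie on the two adjacent files. *)
have JI y : file x < file y -> (y \in val J) = (y \in val I).
  by move=> xy; rewrite toggles_notin //; apply: contraTN xy => /s1_le; rewrite -leNgt.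
have JI' y : file y < file x -> (y \in val J) = (y \in val I').
  move=> yx; rewrite I'E toggles_notin ?toggle_neq //.
    by apply: contraTneq yx => ->; rewrite ltxx.
  by apply: contraTN yx => /s2_ge; rewrite -leNgt.
have -> : mem_at I' x.1 x.2 = (x \in val (toggle x J)).
  by rewrite mem_at_in I'E toggles_notin ?xNs.2.
have -> : mem_at I x.1 x.2 = (x \in val J).
  by rewrite mem_at_in /J toggles_notin ?xNs.1.
rewrite toggle_at; congr (nat_of_bool (_ && _) + nat_of_bool (_ || _))%N.
- case: eqP => // nz; rewrite !orFb; apply: mem_at_eq => y y1 y2; apply: JI.
  by rewrite /file; lia.
- case: eqP => // nz; rewrite !orFb; apply: mem_at_eq => y y1 y2; apply: JI'.
  by rewrite /file; lia.
- by apply: mem_at_eq => y y1 y2; apply: JI'; rewrite /file; lia.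
- by apply: mem_at_eq => y y1 y2; apply: JI; rewrite /file; lia.
Qed.

End Rect.

Arguments mem_at {a b} I k l.

(** * Counting ideals file by file *)

Section FileSums.
Variables a b : nat.
Implicit Types m : nat -> nat -> bool.
Local Open Scope nat_scope.

(* File [i] consists of the points with [l - k = i - a]; by truncated subtraction
   its first point is [(a - i, i - a)].  Points outside the rectangle contribute
   nothing for the [m] considered. *)
Definition file_sum (i : nat) m : nat :=
  \sum_(0 <= j < a + b) m (a - i + j) (i - a + j).

Definition supported m := forall k l, m k l -> (k < a) && (l < b).

Lemma supported_false m k l : supported m -> (a <= k) || (b <= l) -> m k l = false.
Proof. by move=> sm out; apply/negP => /sm; lia. Qed.

Lemma file_sum0 m : supported m -> file_sum 0 m = 0.
Proof. by move=> sm; apply: big1 => j _; rewrite (supported_false m) //; lia. Qed.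

Lemma file_sum_last m : supported m -> file_sum (a + b) m = 0.
Proof. by move=> sm; apply: big1 => j _; rewrite (supported_false m) //; lia. Qed.

(** The disjunction at [j] and the conjunction at [j.+1] involve the same pair [q j], [p j.+1], and
    together contribute its sum. The conjunction at 0 supplies the unpaired [p 0]. *)
Lemma sum_andb_orb (p q : nat -> bool) n : q n = false -> p n.+1 = false ->
  \sum_(0 <= j < n.+1) ((p j && ((j == 0) || q j.-1)) + (q j || p j.+1)) =
  \sum_(0 <= j < n.+1) p j + \sum_(0 <= j < n.+1) q j.
Proof.
move=> qn pn.
suff H r : \sum_(0 <= j < r) ((p j && ((j == 0) || q j.-1)) + (q j || p j.+1)) +
    ((p r && ((r == 0) || q r.-1))) =
    \sum_(0 <= j < r.+1) p j + \sum_(0 <= j < r) q j.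
  by have := H n.+1; rewrite pn /= addn0 => ->; rewrite big_nat_recr //= pn addn0.
elim: r => [|r IH]; first by rewrite big_nat1 !big_geq //= andbT addnC.
rewrite big_nat_recr //= addnA [RHS]addnC.
rewrite [\sum_(0 <= j < r.+1) q j]big_nat_recr //=.
rewrite [\sum_(0 <= j < r.+2) p j]big_nat_recr //=.
by move: IH; case: (p r.+1); case: (q r) => /=; lia.
Qed.

(** Here the pairs are [p j], [q j], and the conjunction at 0 is vacuously true: this is the extra 1
    of the central file. *)
Lemma sum_andb_orb_diag (p q : nat -> bool) n : q n = false -> p n = false ->
  \sum_(0 <= j < n.+1)
     (((j == 0) || p j.-1 && q j.-1) + (q j || p j)) =
  (\sum_(0 <= j < n.+1) p j + \sum_(0 <= j < n.+1) q j).+1.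
Proof.
move=> qn pn.
suff H r : \sum_(0 <= j < r) (((j == 0) || p j.-1 && q j.-1) + (q j || p j)) +
    ((r == 0) || p r.-1 && q r.-1) =
    (\sum_(0 <= j < r) p j + \sum_(0 <= j < r) q j).+1.
  by have := H n.+1; rewrite /= pn qn addn0.
elim: r => [|r IH]; first by rewrite !big_geq.
rewrite !big_nat_recr //=.
by move: IH; case: (p r); case: (q r) => /=; lia.
Qed.

(** The local relation is summed along a file. For [i < a] the file starts on the edge [l = 0], for
    [i > a] on [k = 0], which swaps the roles of [p] and [q]; for [i = a] it starts at the corner,
    where both tests for 0 succeed. *)
Lemma file_sum_promotion m m' (i : nat) : supported m -> supported m' ->
    (forall k l, k < a -> l < b ->
      m' k l + m k l =
      (((k == 0) || m k.-1 l) && ((l == 0) || m' k l.-1)) +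
      (m' k.+1 l || m k l.+1)) ->
    0 < i < a + b ->
  file_sum i m' + file_sum i m =
  file_sum i.-1 m' + file_sum i.+1 m + (i == a).
Proof.
move=> sm sm' H /andP[i_gt0 i_lt].
have z k l := supported_false m k l sm; have z' k l := supported_false m' k l sm'.
(* Outside the rectangle both sides vanish: a test for 0 could succeed there only on the extreme
   files, excluded by [0 < i < a + b]. *)
have Hx j : let k := a - i + j in let l := i - a + j in
    m' k l + m k l =
    (((k == 0) || m k.-1 l) && ((l == 0) || m' k l.-1)) + (m' k.+1 l || m k l.+1).
  move=> k l; case: (boolP ((k < a) && (l < b))) => [/andP[]|out]; first exact: H.
  have [ka|ka] := leqP a k.
    rewrite (z k l) ?ka // (z' k l) ?ka // (z' k.+1 l) ?(leqW ka) // (z k l.+1) ?ka //.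
    have [l0|l0] := posnP l; first lia.
    by rewrite (z' k l.-1) ?ka // orbF andbF.
  have lb : b <= l by rewrite ka -leqNgt in out.
  rewrite (z k l) ?lb ?orbT // (z' k l) ?lb ?orbT //.
  rewrite (z' k.+1 l) ?lb ?orbT // (z k l.+1) ?(leqW lb) ?orbT //.
  have [k0|k0] := posnP k; first lia.
  by rewrite (z k.-1 l) ?lb ?orbT.
rewrite /file_sum -big_split /= (eq_bigr _ (fun j _ => Hx j)) {Hx H}.
rewrite -(prednK (ltn_trans i_gt0 i_lt)); set n := (a + b).-1.
pose p j := m (a - i.+1 + j) (i.+1 - a + j).
pose q j := m' (a - i.-1 + j) (i.-1 - a + j).
rewrite -[X in _ = X + _ + _]/(\sum_(0 <= j < n.+1) q j).
rewrite -[X in _ = _ + X + _]/(\sum_(0 <= j < n.+1) p j).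
have atE f k l k' l' : k = k' -> l = l' -> f k l = f k' l' :> bool by move=> -> ->.
case: (ltngtP i a) => [lt_ia|lt_ai|eq_ia].
- rewrite addn0 addnC -sum_andb_orb.
  + apply: eq_bigr => j _; congr (nat_of_bool (_ && _) + nat_of_bool (_ || _)).
    * by rewrite (_ : _ == 0 = false) ?orFb; [apply: atE|]; lia.
    * by have [->|j0] := posnP j; [|congr (_ || _); [|apply: atE]]; lia.
    * by apply: atE; lia.
    * by apply: atE; lia.
  + by apply: z'; lia.
  + by apply: z; lia.
- rewrite addn0 -sum_andb_orb.
  + apply: eq_bigr => j _; rewrite andbC [X in _ + nat_of_bool X]orbC.
    congr (nat_of_bool (_ && _) + nat_of_bool (_ || _)).
    * by rewrite (_ : _ == 0 = false) ?orFb; [apply: atE|]; lia.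
    * by have [->|j0] := posnP j; [|congr (_ || _); [|apply: atE]]; lia.
    * by apply: atE; lia.
    * by apply: atE; lia.
  + by apply: z; lia.
  + by apply: z'; lia.
- rewrite addn1 [X in _ = X.+1]addnC -sum_andb_orb_diag.
  + apply: eq_bigr => j _; rewrite orb_andr.
    congr (nat_of_bool (_ && _) + nat_of_bool (_ || _)).
    * by have [->|j0] := posnP j; [|congr (_ || _); [|apply: atE]]; lia.
    * by have [->|j0] := posnP j; [|congr (_ || _); [|apply: atE]]; lia.
    * by apply: atE; lia.
    * by apply: atE; lia.
  + by apply: z'; lia.
  + by apply: z; lia.
Qed.

End FileSums.

(** Double counting: each point of the rectangle has exactly one file and one position on it. *)
Lemma card_file_sum (a b : nat) (I : ideals (rect a b)) :
  (\sum_(0 <= i < (a + b).+1) file_sum a b i (mem_at I) = #|val I|)%N.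
Proof.
have mem_atE k l : mem_at I k l =
    (\sum_(x in val I) ((x.1 == k :> nat) && (x.2 == l :> nat)))%N :> nat.
  case: (boolP (mem_at I k l)) => [/exists_inP[x xI /andP[/eqP xk /eqP xl]]|].
    rewrite (bigD1 x) //= xk xl !eqxx big1 // => y /andP[_].
    by rewrite rect_eqE xk xl => /negPf ->.
  by move/exists_inPn => H; rewrite big1 // => x /H /negPf ->.
rewrite /file_sum.
under eq_bigr do under eq_bigr do rewrite mem_atE.
under eq_bigr do rewrite exchange_big /=.
rewrite exchange_big /= -sum1_card; apply: eq_bigr => x _.
have x1 := ltn_ord x.1; have x2 := ltn_ord x.2.
rewrite big_mkord (bigD1 (inord (x.2 + a - x.1)%N)) //=.
rewrite inordK; last lia.
rewrite [X in (_ + X)%N]big1 ?addn0 => [|i ni].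
  (* The first point of a file has a zero coordinate, so the position of [x] is its smaller
     coordinate. *)
  rewrite (bigD1_seq (minn x.1 x.2)) ?iota_uniq ?mem_index_iota //=; last lia.
  rewrite big1 ?addn0 => [|j nj]; first by lia.
  by lia.
rewrite big1 // => j _.
suff : i != (x.2 + a - x.1)%N :> nat by lia.
by apply: contra ni => /eqP <-; rewrite inord_val.
Qed.

(* The two boundary terms are what remains of the summation by parts on [1, r];
   at [r = n - 1] both vanish. *)
Lemma sum_second_difference (F : comNzRingType) (S : nat -> F) (N : F) (n a : nat) :
    S 0%N = 0 -> S n = 0 -> (0 < a < n)%N ->
    (forall i, (0 < i < n)%N ->
      S i + S i = S i.-1 + S i.+1 + N * (i == a)%:R) ->
  2%:R * (\sum_(0 <= i < n.+1) S i) = N * (a * (n - a))%:R.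
Proof.
move=> S0 Sn /andP[a0 an] H.
have parts r : (r < n)%N -> 2%:R * (\sum_(0 <= i < r.+1) S i) =
    r%:R * (n%:R - r%:R) * S r.+1 - r.+1%:R * (n%:R - r.+1%:R) * S r
    + N * (a%:R * (n%:R - a%:R)) * (a <= r)%:R.
  elim: r => [|r IH] lt_rn.
    by rewrite big_nat1 S0 (_ : (a <= 0)%N = false) ?mulr0n; [ring|lia].
  rewrite big_nat_recr //= mulrDr IH ?(ltnW lt_rn) //.
  have {H} := H r.+1 lt_rn; rewrite /= => HS.
  have -> : S r.+2 = S r.+1 + S r.+1 - S r - N * (r.+1 == a)%:R.
    by rewrite HS; ring.
  have -> : (a <= r.+1)%:R = (a <= r)%:R + (r.+1 == a)%:R :> F.
    by rewrite -natrD; congr (_%:R); lia.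
  move: ((a <= r)%:R : F) => c.
  by have [<-|_] := eqVneq r.+1 a; rewrite ?mulr1n ?mulr0n -!natr1; ring.
have n0 : (0 < n)%N by lia.
have := parts n.-1; rewrite prednK // big_nat_recr //= Sn addr0 => -> //.
rewrite (_ : (a <= n.-1)%N = true); last lia.
by rewrite natrM natrB ?(ltnW an) // mulr1n; ring.
Qed.

(** * Averaging over an orbit *)

Lemma sum_orbit_shift (T : finType) (f : T -> T) (O : {set T}) (F : T -> nat) :
    injective f -> is_orbit f O ->
  (\sum_(y in O) F (f y) = \sum_(y in O) F y)%N.
Proof.
move=> f_inj [x ->]; rewrite [RHS](reindex_inj f_inj) /=.
by apply: eq_bigl => y; rewrite !inE -same_fconnect1_r.
Qed.

Theorem theorem19 (a b : nat) (ha : (1 <= a)%N) (hb : (1 <= b)%N)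
    (xs : seq (rect a b)) (hxs : file_enumeration xs) :
  mesic (promotion xs)
    (fun I : ideals (rect a b) => #|val I|%:R) ((a * b)%:R / 2%:R).
Proof.
move=> O orbO.
pose h i (I : ideals (rect a b)) := file_sum a b i (mem_at I).
pose S i : rat := (\sum_(I in O) h i I)%N%:R.
have supp (I : ideals (rect a b)) : supported a b (mem_at I).
  exact: mem_at_support.
have S0 : S 0%N = 0.
  by rewrite /S big1 // => I _; apply: file_sum0.
have Sn : S (a + b)%N = 0.
  by rewrite /S big1 // => I _; apply: file_sum_last.
have Srec i : (0 < i < a + b)%N ->
    S i + S i = S i.-1 + S i.+1 + #|O|%:R * (i == a)%:R.
  move=> i_in; rewrite /S -natrM -!natrD; congr (_%:R).
  (* Promotion permutes [O], so one copy of [S i], and [S i.-1], can be summed over promoted ideals;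
     the recurrence then holds term by term. *)
  have shift j := sum_orbit_shift _ _ O (h j) (toggles_inj (xs := xs)) orbO.
  rewrite -{1}shift -(shift i.-1) -!big_split /= -sum_nat_const -big_split /=.
  apply: eq_bigr => I _; apply: file_sum_promotion => // k l ka lb.
  exact: promotion_at.
have := sum_second_difference _ S #|O|%:R (a + b) a S0 Sn ltac:(lia) Srec.
have -> : \sum_(0 <= i < (a + b).+1) S i = \sum_(I in O) #|val I|%:R.
  rewrite -natr_sum exchange_big natr_sum /=.
  by apply: eq_bigr => I _; rewrite card_file_sum.
rewrite addKn => sumE.
have O_neq0 : #|O|%:R != 0 :> rat.
  rewrite pnatr_eq0 -lt0n; case: orbO => I ->.
  by apply/card_gt0P; exists I; rewrite inE connect0.
apply: (mulfI O_neq0); rewrite mulVKf //.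
by apply: (mulfI (_ : 2%:R != 0)); rewrite // sumE mulrCA [2%:R * _]mulrC divfK.
Qed.
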